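(* Let $L$ be an infinitely distributive lattice. (i) For every $A\subseteq L$, $A^{\sigma_L}=\bigl(\mathscr H_L[A]\bigr)^O_1$. (ii) If $A\subseteq L$ is a (nonempty) sublattice, then a point $x\in L$ belongs to $A^{\sigma_L}$ if and only if the supremum in $L$ of the family $\{x\wedge a: a\in A\}$ exists and $x=\bigvee^{L}_{a\in A}(x\wedge a)$.
   Context: A lattice $L$ is infinitely distributive if it satisfies both: (JID) whenever $\bigvee A$ exists, $x\wedge\bigvee A=\bigvee_{a\in A}(x\wedge a)$ for every $x\in L$; and dually (MID) whenever $\bigwedge A$ exists, $x\vee\bigwedge A=\bigwedge_{a\in A}(x\vee a)$ for every $x\in L$ (the right-hand sides are asserted to exist). A net $(x_\gamma)$ in $L$ order converges to $x\in L$ if there are an (upward) directed set $M\subseteq L$ and a filtered (downward directed) set $N\subseteq L$ with $\bigvee M=x=\bigwedge N$ such that for every $(m,n)\in M\times N$ the net is eventually in $[m,n]=\{z: m\le z\le n\}$. For $A\subseteq L$, $A^O_1$ denotes the set of all $x\in L$ that are order limits of nets in $A$; $A$ is $O$-closed if $A=A^O_1$. An (order) ideal of $L$ is a downset closed under binary joins and containing the least element of $L$ if there is one (so the empty set counts as an ideal exactly when $L$ has no least element). $\mathscr H_L[A]$ is the ideal generated by $A$, i.e. the smallest ideal containing $A$. $A^{\sigma_L}$ is the smallest $O$-closed ideal of $L$ containing $A$. *)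

(* Defs.v *)
From mathcomp Require Import all_boot all_order.
From mathcomp Require Import boolp classical_sets.

Set Implicit Arguments.
Unset Strict Implicit.
Unset Printing Implicit Defensive.

Local Open Scope classical_set_scope.
Local Open Scope order_scope.

(* A join or meet of [A] exists with value [s] when [supremums A s],
   respectively [infimums A s]; such an [s] is unique by antisymmetry. *)

Definition JID d (L : latticeType d) : Prop :=
  forall (A : set L) (s : L), supremums A s ->
  forall x : L, supremums [set Order.meet x a | a in A] (Order.meet x s).

Definition MID d (L : latticeType d) : Prop :=
  forall (A : set L) (i : L), infimums A i ->
  forall x : L, infimums [set Order.join x a | a in A] (Order.join x i).

Definition infinitely_distributive d (L : latticeType d) : Prop :=
  JID L /\ MID L.

(* Directed sets are nonempty. *)
Definition directed (T : Type) (R : T -> T -> Prop) (M : set T) : Prop :=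
  M !=set0 /\
  forall x y, M x -> M y -> exists z, [/\ M z, R x z & R y z].

Definition directed_preorder (I : Type) (R : I -> I -> Prop) : Prop :=
  [/\ forall i, R i i,
      forall i j k, R i j -> R j k -> R i k &
      directed R [set: I]].

Definition order_converges d (L : latticeType d) (I : Type)
    (R : I -> I -> Prop) (u : I -> L) (x : L) : Prop :=
  exists M N : set L,
    [/\ directed (fun a b : L => a <= b) M,
        directed (fun a b : L => b <= a) N,
        supremums M x,
        infimums N x &
        forall m n, M m -> N n ->
          exists i0, forall i, R i0 i -> m <= u i /\ u i <= n].

Definition order_limits d (L : latticeType d) (A : set L) : set L :=
  [set x | exists (I : Type) (R : I -> I -> Prop) (u : I -> L),
    [/\ directed_preorder R, forall i, A (u i) & order_converges R u x]].

Definition O_closed d (L : latticeType d) (A : set L) : Prop :=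
  A = order_limits A.

(* The last clause makes the empty set an ideal exactly when [L] has no least
   element. *)
Definition ideal d (L : latticeType d) (J : set L) : Prop :=
  [/\ forall x y, J y -> x <= y -> J x,
      forall x y, J x -> J y -> J (Order.join x y) &
      forall b : L, (forall y, b <= y) -> J b].

(* [smallest C A] is the intersection of all the [C]-sets containing [A];
   ideals and O-closed ideals are both stable under arbitrary intersections. *)
Definition ideal_hull d (L : latticeType d) (A : set L) : set L :=
  smallest (@ideal d L) A.

Definition sigma_hull d (L : latticeType d) (A : set L) : set L :=
  smallest (fun J : set L => ideal J /\ O_closed J) A.

Definition sublattice d (L : latticeType d) (A : set L) : Prop :=
  A !=set0 /\
  forall x y, A x -> A y -> A (Order.meet x y) /\ A (Order.join x y).

(* Main.v *)
Require Import Defs.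
From mathcomp Require Import all_boot all_order.
From mathcomp Require Import boolp classical_sets.

Import Order.TTheory.

Local Open Scope classical_set_scope.

(** The idea is to replace nets by joins.  If a net in an ideal [J] order
    converges to [x], witnessed by [M] and [N], then every [m] in [M] lies below
    some term of the net, so [M] is a directed subset of [J] with join [x].
    Conversely a directed set, viewed as a net indexed by itself, order
    converges to its join.  Hence the order limits of an ideal [J] are exactly
    the points that are the join of the elements of [J] below them; this is
    [order_limits_ideal], and the set of such points is [join_closure J].

    With this description the join infinite distributive law makes
    [join_closure J] a downset ([ideal_join_closure]), and it is O-closed because
    a join of joins of elements of [J] is a join of elements of [J].  So one step
    of taking order limits of the ideal generated by [A] already gives an
    O-closed ideal, which proves the first claim.  For a sublattice [A] the
    generated ideal is the downward closure of [A], and the elements of that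
    ideal below [x] have the same upper bounds as the meets of [x] with elements
    of [A]; this gives the second claim. *)

Definition join_closure {d} {L : latticeType d} (J : set L) : set L :=
  [set x | supremums (J `&` [set y | y <= x]%O) x].

Section JoinClosure.
Context {d : Order.disp_t} {L : latticeType d}.
Implicit Types (A J M : set L) (x y z : L).

(** Membership in the join closure reduces to leastness, since [x] always bounds
    the elements below it. *)
Lemma join_closureP J x :
  join_closure J x <-> forall z, (forall y, J y -> y <= x -> y <= z)%O -> (x <= z)%O.
Proof.
split=> [[_ lub_x] z ub_z | lub_x].
  by apply: lub_x => y [Jy le_yx]; exact: ub_z.
split=> [y [] // | z ub_z]; apply: lub_x => y Jy le_yx.
by apply: ub_z.
Qed.

Lemma sub_join_closure J : J `<=` join_closure J.
Proof. by move=> x Jx; apply/join_closureP => z; apply. Qed.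

Lemma join_closure_idem J : join_closure (join_closure J) = join_closure J.
Proof.
apply/seteqP; split; last exact: sub_join_closure.
move=> x /join_closureP lub_x; apply/join_closureP => z ub_z.
apply: lub_x => k /join_closureP lub_k le_kx.
by apply: lub_k => y Jy le_yk; apply: ub_z (le_trans le_yk le_kx).
Qed.

(** The net is the inclusion of [M], ordered by the lattice order; the filtered
    set witnessing convergence from above is the singleton of the join. *)
Lemma directed_sup_order_limit J M x :
  directed (fun a b : L => a <= b)%O M -> M `<=` J -> supremums M x ->
  order_limits J x.
Proof.
move=> dirM subMJ supM; have [ub_x _] := supM.
exists {m | M m}, (fun i j => sval i <= sval j)%O, sval; split.
- split=> [i | i j k | ]; [exact: lexx | exact: le_trans | split].
    by case: dirM => -[m Mm] _; exists (exist _ m Mm).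
  move=> [m Mm] [n Mn] _ _; have [p [Mp le_mp le_np]] := dirM.2 m n Mm Mn.
  by exists (exist _ p Mp).
- by case=> m /= /subMJ.
- exists M, [set x]; split=> //.
  + by split=> [|y z -> ->]; [exists x | exists x; split].
  + by split=> [y -> // | z]; apply.
  + move=> m _ Mm ->; exists (exist _ m Mm) => -[n Mn] /= le_mn.
    by split=> //; exact: ub_x.
Qed.

Lemma order_limitsS A J : A `<=` J -> order_limits A `<=` order_limits J.
Proof.
move=> subAJ x [I [R [u [dirR uA cvu]]]]; exists I, R, u; split=> // i.
exact: subAJ.
Qed.

Lemma order_limits_ideal J : ideal J -> order_limits J = join_closure J.
Proof.
move=> [downJ joinJ botJ]; apply/seteqP; split=> x.
  move=> [I [R [u [[reflR _ _] uJ]]]].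
  move=> [M [N [_ [[n Nn] _] [ub_x lub_x] _ cvu]]].
  apply/join_closureP => z ub_z; apply: lub_x => m Mm.
  have [i0 tail_i0] := cvu m n Mm Nn; have [le_mu _] := tail_i0 i0 (reflR i0).
  by apply: ub_z (ub_x m Mm); exact: downJ (uJ i0) le_mu.
move=> Jx; apply: directed_sup_order_limit (Jx) => [|y [] //]; split.
  (* If no element of [J] were below [x], the empty join [x] would be least, and
     an ideal contains the least element. *)
  apply: contrapT => J0; apply: (J0); exists x; split; last exact: lexx.
  apply: botJ; move/join_closureP: Jx => lub_x y; apply: lub_x => w Jw le_wx.
  by case: J0; exists w.
move=> y z [Jy le_yx] [Jz le_zx]; exists (Order.join y z).
by split; [split; [exact: joinJ | rewrite /= leUx le_yx] | exact: leUl | exact: leUr].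
Qed.

(** For [y <= x], distributivity writes [y] as the join of the [y `&` j] with [j]
    in [J] below [x], and these stay in the downset [J]. *)
Lemma ideal_join_closure J : JID L -> ideal J -> ideal (join_closure J).
Proof.
move=> jid [downJ joinJ botJ]; split.
- move=> y x Jx le_yx; apply/join_closureP => z ub_z.
  have [_] := jid _ _ Jx y; rewrite (meet_idPl le_yx); apply.
  by move=> _ [j [Jj _] <-]; apply: ub_z; [apply: downJ Jj _; exact: leIr | exact: leIl].
- move=> x y /join_closureP lub_x /join_closureP lub_y.
  apply/join_closureP => z ub_z; rewrite leUx.
  apply/andP; split; [apply: lub_x | apply: lub_y] => w Jw le_w;
    apply: ub_z => //; apply: le_trans le_w _; [exact: leUl | exact: leUr].
- by move=> b /botJ; exact: sub_join_closure.
Qed.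

Lemma O_closed_join_closure J :
  JID L -> ideal J -> O_closed (join_closure J).
Proof.
move=> jid idJ; rewrite /O_closed order_limits_ideal ?join_closure_idem //.
exact: ideal_join_closure.
Qed.

Lemma ideal_ideal_hull A : ideal (ideal_hull A).
Proof.
split=> [y x Ax le_yx | x y Ax Ay | b le_b] J [idJ subAJ];
  have [downJ joinJ botJ] := idJ.
- by apply: downJ le_yx; exact: Ax.
- by apply: joinJ; [exact: Ax | exact: Ay].
- exact: botJ.
Qed.

Lemma sigma_hullE A : JID L -> sigma_hull A = order_limits (ideal_hull A).
Proof.
move=> jid; have idH := ideal_ideal_hull A; apply/seteqP; split.
  rewrite order_limits_ideal //; apply: smallest_sub.
    by split; [exact: ideal_join_closure | exact: O_closed_join_closure].
  by apply: subset_trans (sub_join_closure _); exact: sub_smallest.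
move=> x limHx J [[idJ clJ] subAJ]; rewrite clJ.
by apply: order_limitsS limHx; exact: smallest_sub.
Qed.

(** Closure under binary joins makes the downward closure of a sublattice an
    ideal; being nonempty, it also contains the least element if there is
    one. *)
Lemma ideal_hull_sublattice A :
  sublattice A -> ideal_hull A = [set y | exists2 a, A a & (y <= a)%O].
Proof.
move=> [[a0 Aa0] subA]; apply/seteqP; split.
  apply: smallest_sub => [|a Aa]; last by exists a.
  split=> [y x [a Aa le_xa] le_yx | x y [a Aa le_xa] [b Ab le_yb] | b le_b].
  - by exists a => //; exact: le_trans le_xa.
  - by exists (Order.join a b); [case: (subA a b Aa Ab) | exact: leU2].
  - by exists a0.
move=> y [a Aa le_ya]; have [downH _ _] := ideal_ideal_hull A.
by apply: downH le_ya; exact: sub_smallest Aa.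
Qed.

Lemma join_closure_downset A x :
  join_closure [set y | exists2 a, A a & (y <= a)%O] x <->
  supremums [set Order.meet x a | a in A] x.
Proof.
split=> [/join_closureP lub_x | [_ lub_x]].
  split=> [_ [a _ <-] | z ub_z]; first exact: leIl.
  apply: lub_x => y [a Aa le_ya] le_yx.
  apply: (@le_trans _ _ (Order.meet x a)); first by rewrite lexI le_yx.
  by apply: ub_z; exists a.
apply/join_closureP => z ub_z; apply: lub_x => _ [a Aa <-].
by apply: ub_z; [exists a => //; exact: leIr | exact: leIl].
Qed.

End JoinClosure.

Theorem proposition3p3 (d : Order.disp_t) (L : latticeType d)
    (hL : infinitely_distributive L) :
  (forall A : set L, sigma_hull A = order_limits (ideal_hull A)) /\
  (forall A : set L, sublattice A ->
    forall x : L,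
      sigma_hull A x <-> supremums [set Order.meet x a | a in A] x).
Proof.
have [jid _] := hL; split=> [A | A subA x]; first exact: sigma_hullE.
rewrite sigma_hullE // order_limits_ideal; last exact: ideal_ideal_hull.
by rewrite ideal_hull_sublattice //; exact: join_closure_downset.
Qed.
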